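(* Let $(G,+)$ be a group (not necessarily abelian), let $R$ be a reflexive relation on $G$, and let $A,B$ be nonempty subsets of $G$. Assume that $R$ is isotone. If $\mathscr{E}(A)=\emptyset$, then $\mathscr{E}(A+B)=\mathscr{E}(A)$.
   Context: For $x,y\in G$, $xPy$ means that $xRy$ holds and $yRx$ does not. $R$ is isotone if for all $g,g',z\in G$, $gRg'$ implies $(z+g)R(z+g')$ and $(g+z)R(g'+z)$. The sum set is $A+B=\{a+b: a\in A, b\in B\}$. For $S\subseteq G$, $\mathscr{E}(S)$ is the set of efficient points of $S$, i.e. of those $g\in S$ for which there is no $g'\in S$ with $g'Pg$; by convention $\mathscr{E}(\emptyset)=\emptyset$. *)

(* Defs.v *)
(* The group is an arbitrary (possibly infinite, possibly nonabelian)
   [groupType].  The library's additive groups ([zmodType]) are abelian, so the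
   group law is written multiplicatively: [x * y] in [group_scope] stands for
   the additive "x + y". *)
From mathcomp Require Import all_boot.
From mathcomp Require Import boolp classical_sets.

Set Implicit Arguments.
Unset Strict Implicit.
Unset Printing Implicit Defensive.

Local Open Scope classical_set_scope.

Definition strict_part (T : Type) (R : T -> T -> Prop) (x y : T) : Prop :=
  R x y /\ ~ R y x.

Definition isotone (G : groupType) (R : G -> G -> Prop) : Prop :=
  forall g g' z : G, R g g' -> R (z * g)%g (z * g')%g /\ R (g * z)%g (g' * z)%g.

Definition sumset (G : groupType) (A B : set G) : set G :=
  [set (a * b)%g | a in A & b in B].

(* A point is efficient when nothing in [S] is strictly [R]-related *to* it:
   the dominating point is the left argument. *)
Definition efficient (T : Type) (R : T -> T -> Prop) (S : set T) : set T :=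
  [set g | S g /\ ~ (exists2 g', S g' & strict_part R g' g)].

(* Main.v *)
Require Import Defs.
From mathcomp Require Import all_boot.
From mathcomp Require Import boolp classical_sets.

(** Right translation by a fixed element preserves strict domination, because
    translating back by the inverse would turn a converse relation between the
    translates into a converse relation between the original points.  So a point
    of [A] dominating [a] yields, after translation by [b], a point of the sum
    set dominating [a * b].  Hence an efficient point of the sum set can only
    come from an efficient point of [A], and if [A] has none then neither does
    the sum set. *)

Local Open Scope classical_set_scope.

(** Isotonicity alone gives only the [R] half; the [~ R] half is where
    invertibility of [z] is used. *)
Lemma strict_part_mulr (G : groupType) (R : G -> G -> Prop) (x y z : G) :
  isotone R -> strict_part R x y -> strict_part R (x * z)%g (y * z)%g.
Proof.
move=> Riso [Rxy nRyx]; split; first by case: (Riso _ _ z Rxy).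
by move=> /(Riso _ _ z^-1%g)[_]; rewrite !mulgK.
Qed.

Lemma efficient_sumset_left (G : groupType) (R : G -> G -> Prop) (A B : set G)
    (a b : G) :
  isotone R -> A a -> B b -> efficient R (sumset A B) (a * b)%g ->
  efficient R A a.
Proof.
move=> Riso Aa Bb [_ undominated]; split=> // -[a' Aa' Pa'a].
apply: undominated; exists (a' * b)%g; last exact: strict_part_mulr.
by exists a' => //; exists b.
Qed.

Theorem theorem1 (G : groupType) (R : G -> G -> Prop) (A B : set G)
    (Rrefl : forall g : G, R g g)
    (A_nonempty : A !=set0) (B_nonempty : B !=set0)
    (Riso : isotone R) (EA0 : efficient R A = set0) :
  efficient R (sumset A B) = efficient R A.
Proof.
rewrite EA0 -subset0 => g Eg.
have [[a Aa [b Bb abg]] _] := Eg; rewrite -abg in Eg.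
have := @efficient_sumset_left G R A B a b Riso Aa Bb Eg.
by rewrite EA0.
Qed.
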